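(* Let $(\mathcal{J}_1,\bullet_1,B)$ be a pseudo-euclidean mock-Lie superalgebra, $(\mathcal{J}_2,\bullet_2)$ a mock-Lie superalgebra, $\phi:\mathcal{J}_2\to\mathfrak{AnDer}_s(\mathcal{J}_1)$ a representation of mock-Lie superalgebras, and let $\mathcal{J}=\mathcal{J}_2\oplus\mathcal{J}_1\oplus\mathcal{J}_2^*$ be the mock-Lie superalgebra with product $$(a+x+f)\bullet_d(b+y+g)=a\bullet_2b+x\bullet_1y+\phi(a)(y)+(-1)^{|x||y|}\phi(b)(x)+L_2^*(a)(g)+(-1)^{|x||y|}L_2^*(b)(f)+\varphi(x,y),$$ where $\varphi(x,y)(a)=(-1)^{|x|(|y|+|a|)}B(y,\phi(a)(x))$ and $L_2^*$ is the coadjoint representation of $\mathcal{J}_2$. Let $\sigma$ be a supersymmetric invariant bilinear form on $\mathcal{J}_2$. Then the bilinear form defined on $\mathcal{J}$ by $$\tilde B(a+x+f,b+y+g)=B(x,y)+\sigma(a,b)+f(b)+(-1)^{|x||y|}g(a)$$ is a supersymmetric invariant bilinear form on $\mathcal{J}$.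
   Context: All vector spaces are finite-dimensional over a field $\mathbb{K}$ of characteristic $0$; $|x|$ denotes the degree of a homogeneous element $x$ of a $\mathbb{Z}_2$-graded space; dual spaces carry the natural grading. For homogeneous $a+x+f$ and $b+y+g$ in $\mathcal{J}_2\oplus\mathcal{J}_1\oplus\mathcal{J}_2^*$ one has $|a|=|x|=|f|$ and $|b|=|y|=|g|$; formulas are extended bilinearly. A mock-Lie superalgebra is a $\mathbb{Z}_2$-graded vector space $\mathcal{J}$ with an even bilinear product $\bullet$ (i.e. $\mathcal{J}_i\bullet\mathcal{J}_j\subset\mathcal{J}_{i+j}$) such that for all homogeneous $x,y,z$: $x\bullet y=(-1)^{|x||y|}y\bullet x$, and $(-1)^{|x||z|}x\bullet(y\bullet z)+(-1)^{|x||y|}y\bullet(z\bullet x)+(-1)^{|y||z|}z\bullet(x\bullet y)=0$. A bilinear form $B$ on it is even if $B(\mathcal{J}_{\bar0},\mathcal{J}_{\bar1})=B(\mathcal{J}_{\bar1},\mathcal{J}_{\bar0})=0$, supersymmetric if $B(x,y)=(-1)^{|x||y|}B(y,x)$, invariant if $B(x\bullet y,z)=B(x,y\bullet z)$. A pseudo-euclidean mock-Lie superalgebra is one equipped with an even, supersymmetric, non-degenerate, invariant bilinear form. An anti-superderivation of degree $\alpha$ of $\mathcal{J}$ is $D\in\mathrm{End}(\mathcal{J})_\alpha$ with $D(x\bullet y)=-D(x)\bullet y-(-1)^{\alpha|x|}x\bullet D(y)$. It is supersymmetric with respect to $B$ if $B(D(x),y)=(-1)^{\alpha|x|}B(x,D(y))$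 for all homogeneous $x$ and all $y$; $\mathfrak{AnDer}_s(\mathcal{J})$ is the graded space of supersymmetric anti-superderivations. A representation of $\mathcal{J}$ on a $\mathbb{Z}_2$-graded space $\mathcal{V}$ is an even linear map $\pi:\mathcal{J}\to\mathrm{End}(\mathcal{V})$ with $\pi(x\bullet y)=-\pi(x)\pi(y)-(-1)^{|x||y|}\pi(y)\pi(x)$ for homogeneous $x,y$; $\phi$ is a representation of $\mathcal{J}_2$ on $\mathcal{J}_1$ with values in $\mathfrak{AnDer}_s(\mathcal{J}_1)$. The coadjoint representation is $L_2^*(a)(f)=(-1)^{|f||a|}f\circ L_2(a)$, where $L_2(a)(b)=a\bullet_2b$. *)

(* Defs.v *)
From HB Require Import structures.
From mathcomp Require Import all_boot all_order all_algebra.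
From mathcomp Require Import ring.

Set Implicit Arguments.
Unset Strict Implicit.
Unset Printing Implicit Defensive.

Import GRing.Theory.
Local Open Scope ring_scope.

(* The group Z_2 is represented by bool: addition of degrees is (+) (xor), and
   the sign (-1)^(|x||y|) is (-1) ^+ (i && j) for x, y of degrees i, j.      *)

Record grading (K : fieldType) (V : vectType K) := Grading {
  gpart :> bool -> {vspace V};
  grading_sum : (gpart false + gpart true)%VS = fullv;
  grading_cap : (gpart false :&: gpart true)%VS = 0%VS
}.

Section Graded.
Variables (K : fieldType) (V : vectType K) (G : grading V).

Definition hcomp (i : bool) : 'End(V) := daddv_pi (G i) (G (~~ i)).

Lemma grading_capN i : (G i :&: G (~~ i))%VS = 0%VS.
Proof. by case: i; rewrite ?grading_cap // capvC grading_cap. Qed.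

Lemma mem_hcomp i v : hcomp i v \in G i.
Proof. exact: memv_pi. Qed.

Lemma hcomp_id i v : v \in G i -> hcomp i v = v.
Proof. exact: daddv_pi_id (grading_capN i). Qed.

Lemma hcomp_sum v : \sum_i hcomp i v = v.
Proof.
rewrite big_bool /= addrC; apply: daddv_pi_add; first exact: grading_cap.
by rewrite grading_sum memvf.
Qed.

Lemma hcompN0 i v : v \in G (~~ i) -> hcomp i v = 0.
Proof.
move=> vG; have := hcomp_sum v; rewrite big_bool /=.
by case: i vG => /= /hcomp_id ->; [rewrite -{3}[v]add0r => /addIr
                                  | rewrite -{3}[v]addr0 => /addrI].
Qed.

Lemma hcompE i j v : v \in G j -> hcomp i v = if i == j then v else 0.
Proof.
case: eqP => [-> | /eqP nij vG]; first exact: hcomp_id.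
by apply: hcompN0; move: nij vG; case: i; case: j.
Qed.

End Graded.

(* Extension to all vectors of a formula F i j u v given for u of degree i and
   v of degree j.                                                            *)
Section BilinearExtension.
Variables (K : fieldType) (U V : vectType K) (W : zmodType).
Variables (GU : grading U) (GV : grading V).

Definition hext2 (F : bool -> bool -> U -> V -> W) (u : U) (v : V) : W :=
  \sum_(i : bool) \sum_(j : bool) F i j (hcomp GU i u) (hcomp GV j v).

End BilinearExtension.

Section HExt2.
Variables (K : fieldType) (U V : vectType K) (W : lmodType K).
Variables (GU : grading U) (GV : grading V).
Variable F : bool -> bool -> U -> V -> W.
Hypothesis F_bilin : forall i j, bilinear_for *:%R *:%R (F i j).

Lemma hext2_bilinear : bilinear_for *:%R *:%R (hext2 GU GV F).
Proof.
split=> [v a u u'|u a v v'] /=; rewrite /hext2 scaler_sumr -big_split /=;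
  apply: eq_bigr => i _; rewrite scaler_sumr -big_split /=;
  apply: eq_bigr => j _; rewrite linearP.
- exact: (F_bilin i j).1.
- exact: (F_bilin i j).2.
Qed.

Lemma hext2E i j u v : u \in GU i -> v \in GV j -> hext2 GU GV F u v = F i j u v.
Proof.
move=> uG vG; rewrite /hext2.
have F0r k l x : F k l x 0 = 0.
  by have := (F_bilin k l).2 x (-1) 0 0; rewrite /= scaler0 addr0 scaleN1r addNr.
have F0l k l y : F k l 0 y = 0.
  by have := (F_bilin k l).1 y (-1) 0 0; rewrite /= scaler0 addr0 scaleN1r addNr.
by rewrite !big_bool !(hcompE _ uG) !(hcompE _ vG);
   case: i uG; case: j vG => * /=; rewrite ?F0r ?F0l ?addr0 ?add0r.
Qed.
End HExt2.

Record mockLie (K : fieldType) (V : vectType K) (G : grading V) := MockLie {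
  mlmul : {bilinear V -> V -> V};
  mlmul_even : forall i j x y,
    x \in G i -> y \in G j -> mlmul x y \in G (i (+) j);
  mlmulC : forall i j x y, x \in G i -> y \in G j ->
    mlmul x y = (-1) ^+ (i && j) *: mlmul y x;
  mlmul_jacobi : forall i j k x y z, x \in G i -> y \in G j -> z \in G k ->
    (-1) ^+ (i && k) *: mlmul x (mlmul y z)
    + (-1) ^+ (i && j) *: mlmul y (mlmul z x)
    + (-1) ^+ (j && k) *: mlmul z (mlmul x y) = 0
}.

Section Forms.
Variables (K : fieldType) (V : vectType K) (G : grading V).
Implicit Types (J : mockLie G) (B : V -> V -> K) (D : 'End(V)).

Definition even_form B := forall i x y, x \in G i -> y \in G (~~ i) -> B x y = 0.

Definition supersymmetric_form B := forall i j x y,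
  x \in G i -> y \in G j -> B x y = (-1) ^+ (i && j) * B y x.

(* Non-degeneracy on one side suffices: the forms it is applied to are
   supersymmetric.                                                           *)
Definition nondegenerate_form B := forall x, (forall y, B x y = 0) -> x = 0.

Definition invariant_form J B := forall x y z,
  B (mlmul J x y) z = B x (mlmul J y z).

Definition pseudo_euclidean J B :=
  [/\ even_form B, supersymmetric_form B, nondegenerate_form B
    & invariant_form J B].

Definition degree_end (d : bool) D := forall i x, x \in G i -> D x \in G (d (+) i).

Definition anti_superderivation J (d : bool) D :=
  degree_end d D /\
  forall i x y, x \in G i ->
    D (mlmul J x y)
    = - mlmul J (D x) y - (-1) ^+ (d && i) *: mlmul J x (D y).

Definition supersymmetric_end B (d : bool) D := forall i x y,
  x \in G i -> B (D x) y = (-1) ^+ (d && i) * B x (D y).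

(* Membership in the graded space AnDer_s(J): D is the sum of its homogeneous
   components, each of which is a supersymmetric anti-superderivation.       *)
Definition AnDer_s J B D := exists D_ : bool -> 'End(V),
  D = \sum_d D_ d /\
  forall d, anti_superderivation J d (D_ d) /\ supersymmetric_end B d (D_ d).

End Forms.

Definition representation (K : fieldType) (V W : vectType K) (G : grading V)
    (J : mockLie G) (GW : grading W) (phi : {linear V -> 'End(W)}) :=
  (forall i x, x \in G i -> degree_end GW i (phi x)) /\
  (forall i j x y, x \in G i -> y \in G j ->
     phi (mlmul J x y)
     = - (phi x \o phi y)%VF - (-1) ^+ (i && j) *: (phi y \o phi x)%VF).

Section DualGrading.
Variables (K : fieldType) (V : vectType K) (G : grading V).

Definition dual_space : vectType K := 'Hom(V, K^o).

Definition precomp (D : 'End(V)) (f : dual_space) : dual_space := (f \o D)%VF.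

Lemma precomp_linear D : linear (precomp D).
Proof. by move=> a f g; rewrite /precomp comp_lfunDl comp_lfunZl. Qed.

HB.instance Definition _ D :=
  GRing.isLinear.Build K dual_space dual_space _ (precomp D) (precomp_linear D).

(* The linear forms of degree i are those that vanish on G (~~ i).           *)
Definition dual_part (i : bool) : {vspace dual_space} :=
  lker (linfun (precomp (hcomp G (~~ i)))).

Lemma dual_partP i (f : dual_space) :
  reflect (forall c, c \in G (~~ i) -> f c = 0) (f \in dual_part i).
Proof.
rewrite memv_ker lfunE /=; apply: (iffP eqP) => [f0 c cG|f0].
  by have := congr1 (fun g : 'Hom(V, K^o) => g c) f0;
     rewrite /precomp lfunE /= hcomp_id // lfunE.
by apply/lfunP => c; rewrite /precomp lfunE /= f0 ?lfunE // mem_hcomp.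
Qed.

Lemma dual_part_sum : (dual_part false + dual_part true)%VS = fullv.
Proof.
apply/vspaceP => f; rewrite memvf.
have -> : f = precomp (hcomp G false) f + precomp (hcomp G true) f.
  apply/lfunP => c; rewrite add_lfunE !comp_lfunE -linearD /=.
  by have := hcomp_sum G c; rewrite big_bool /= addrC => ->.
by rewrite memv_add //; apply/dual_partP => c cG /=;
   rewrite comp_lfunE (hcompE _ cG) linear0.
Qed.

Lemma dual_part_cap : (dual_part false :&: dual_part true)%VS = 0%VS.
Proof.
apply/eqP; rewrite -subv0; apply/subvP => f.
rewrite memv_cap memv0 => /andP[/dual_partP f0 /dual_partP f1].
apply/eqP/lfunP => c; rewrite -[c](hcomp_sum G) !linear_sum !big_bool /=.
by rewrite f0 ?f1 ?mem_hcomp // !lfunE /= addr0.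
Qed.

Definition dual_grading : grading dual_space :=
  Grading dual_part_sum dual_part_cap.
End DualGrading.

(* The grading of V2 (+) V1 (+) V2^*: a + x + f, encoded as (a, x, f), has
   degree i when a, x and f all have.                                        *)
Section DoubleExtensionGrading.
Variables (K : fieldType) (V1 V2 : vectType K).
Variables (G1 : grading V1) (G2 : grading V2).

Definition dext_space : vectType K := (V2 * V1 * dual_space V2)%type.
Implicit Types u v w : dext_space.

Definition dext_2 u : V2 := u.1.1.
Definition dext_1 u : V1 := u.1.2.
Definition dext_dual u : dual_space V2 := u.2.

Lemma dext_2_linear : linear dext_2. Proof. by []. Qed.
Lemma dext_1_linear : linear dext_1. Proof. by []. Qed.
Lemma dext_dual_linear : linear dext_dual. Proof. by []. Qed.
HB.instance Definition _ :=
  GRing.isLinear.Build K dext_space V2 _ dext_2 dext_2_linear.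
HB.instance Definition _ :=
  GRing.isLinear.Build K dext_space V1 _ dext_1 dext_1_linear.
HB.instance Definition _ :=
  GRing.isLinear.Build K dext_space (dual_space V2) _ dext_dual dext_dual_linear.

Definition dext_part (i : bool) : {vspace dext_space} :=
  (linfun dext_2 @^-1: G2 i :&: linfun dext_1 @^-1: G1 i
   :&: linfun dext_dual @^-1: dual_grading G2 i)%VS.

Lemma mem_dext_part i (a : V2) (x : V1) (f : dual_space V2) :
  ((a, x, f) : dext_space) \in dext_part i
  = [&& a \in G2 i, x \in G1 i & f \in dual_grading G2 i].
Proof. by rewrite !memv_cap -!memv_preim !lfunE /= andbA. Qed.

Lemma dext_part_sum : (dext_part false + dext_part true)%VS = fullv.
Proof.
apply/vspaceP => -[[a x] f]; rewrite memvf.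
pose H i : dext_space := (hcomp G2 i a, hcomp G1 i x, hcomp (dual_grading G2) i f).
have -> : (a, x, f) = H false + H true.
  have := hcomp_sum G2 a; have := hcomp_sum G1 x.
  have := hcomp_sum (dual_grading G2) f; rewrite !big_bool /= => ef ex ea.
  by rewrite -{1}ef -{1}ex -{1}ea /H; congr (_, _, _); rewrite addrC.
by rewrite memv_add // mem_dext_part !mem_hcomp.
Qed.

Lemma dext_part_cap : (dext_part false :&: dext_part true)%VS = 0%VS.
Proof.
apply/eqP; rewrite -subv0; apply/subvP => -[[a x] f].
rewrite memv_cap !mem_dext_part memv0 => /andP[/and3P[a0 x0 f0] /and3P[a1 x1 f1]].
have cap0 (U : vectType K) (G : grading U) z : z \in G false -> z \in G true -> z = 0.
  by move=> z0 z1; apply/eqP; rewrite -memv0 -(grading_cap G) memv_cap z0.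
by rewrite (cap0 _ _ _ a0 a1) (cap0 _ _ _ x0 x1) (cap0 _ (dual_grading G2) _ f0 f1).
Qed.

Definition dext_grading : grading dext_space :=
  Grading dext_part_sum dext_part_cap.

Lemma mem_dext i (a : V2) (x : V1) (f : dual_space V2) :
  ((a, x, f) : dext_space) \in dext_grading i
  = [&& a \in G2 i, x \in G1 i & f \in dual_grading G2 i].
Proof. exact: mem_dext_part. Qed.
End DoubleExtensionGrading.

Section DoubleExtension.
Variables (K : fieldType) (V1 V2 : vectType K).
Variables (G1 : grading V1) (G2 : grading V2).
Variables (J1 : mockLie G1) (J2 : mockLie G2).
Variables (B : {biscalar V1}) (phi : {linear V2 -> 'End(V1)}).

Definition left_mul (a : V2) : 'End(V2) := linfun (mlmul J2 a).

(* In this section the boolean arguments are the degrees of the vectors that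
   follow them; the formulas are meant for vectors of those degrees and
   are extended bilinearly by hext2.                                         *)

Definition coadjoint (i j : bool) (a : V2) (f : dual_space V2) : dual_space V2 :=
  (-1) ^+ (j && i) *: (f \o left_mul a)%VF.

(* The sign depends on the degree of the argument c of the linear form, hence
   the sum over the homogeneous components of c.                             *)
Definition dext_varphi (i j : bool) (x y : V1) : dual_space V2 :=
  linfun (fun c : V2 =>
    \sum_(k : bool) (-1) ^+ (i && (j (+) k)) * B y (phi (hcomp G2 k c) x) : K^o).

Definition dext_mul_hom (i j : bool) (u v : dext_space V1 V2) : dext_space V1 V2 :=
  let a := dext_2 u in let x := dext_1 u in let f := dext_dual u in
  let b := dext_2 v in let y := dext_1 v in let g := dext_dual v in
  (mlmul J2 a b,
   mlmul J1 x y + phi a y + (-1) ^+ (i && j) *: phi b x,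
   coadjoint i j a g + (-1) ^+ (i && j) *: coadjoint j i b f
   + dext_varphi i j x y).

Definition dext_mul : dext_space V1 V2 -> dext_space V1 V2 -> dext_space V1 V2 :=
  hext2 (dext_grading G1 G2) (dext_grading G1 G2) dext_mul_hom.

Definition dext_form (sigma : V2 -> V2 -> K) :
    dext_space V1 V2 -> dext_space V1 V2 -> K :=
  hext2 (dext_grading G1 G2) (dext_grading G1 G2) (fun i j u v =>
    let a := dext_2 u in let x := dext_1 u in let f := dext_dual u in
    let b := dext_2 v in let y := dext_1 v in let g := dext_dual v in
    B x y + sigma a b + f b + (-1) ^+ (i && j) * g a).

Lemma left_mulE a b : left_mul a b = mlmul J2 a b.
Proof. by rewrite lfunE. Qed.

Lemma coadjointE i j a f c :
  coadjoint i j a f c = (-1) ^+ (j && i) * f (mlmul J2 a c) :> K.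
Proof. by rewrite scale_lfunE comp_lfunE left_mulE. Qed.

Lemma dext_varphi_linear i j x y : linear (fun c : V2 =>
  \sum_(k : bool) (-1) ^+ (i && (j (+) k)) * B y (phi (hcomp G2 k c) x) : K^o).
Proof.
move=> t c d; rewrite /= scaler_sumr -big_split; apply: eq_bigr => k _ /=.
rewrite !linearP add_lfunE scale_lfunE linearPr mulrDr; congr (_ + _).
by rewrite mulrCA.
Qed.

Lemma dext_varphiE i j k x y c : c \in G2 k ->
  dext_varphi i j x y c = (-1) ^+ (i && (j (+) k)) * B y (phi c x) :> K.
Proof.
move=> cG.
pose F : {linear V2 -> K^o} :=
  HB.pack (fun c : V2 => \sum_(k : bool) _ : K^o)
    (GRing.isLinear.Build K V2 K^o _ _ (dext_varphi_linear i j x y)).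
rewrite /dext_varphi -[LHS]/(linfun F c) lfunE /= /F /= big_bool !(hcompE _ cG).
by case: k cG => _ /=;
  rewrite linear0 lfunE /= linear0r mulr0 ?addr0 ?add0r.
Qed.

Lemma dext_eq (u v : dext_space V1 V2) : dext_2 u = dext_2 v ->
  dext_1 u = dext_1 v -> dext_dual u = dext_dual v -> u = v.
Proof.
by move: u v => [[a x] f] [[b y] g]; rewrite /dext_2 /dext_1 /dext_dual /=;
   move=> -> -> ->.
Qed.

Lemma dual_eq (f g : dual_space V2) :
  (forall k c, c \in G2 k -> f c = g c) -> f = g.
Proof.
move=> fg; apply/lfunP => c; rewrite -[c](hcomp_sum G2) !linear_sum.
by apply: eq_bigr => k _; apply: fg (mem_hcomp _ _ _).
Qed.

Lemma dext_mul_hom_bilinear i j : bilinear_for *:%R *:%R (dext_mul_hom i j).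
Proof.
have addr3 (W : zmodType) (p p' q q' r r' : W) :
  (p + p') + (q + q') + (r + r') = (p + q + r) + (p' + q' + r').
  by rewrite (addrACA p p' q) (addrACA (p + q)).
have scaleE (t b : K) : t *: (b : K^o) = t * b by [].
split=> [[[b y] g] t [[a x] f] [[a' x'] f'] | [[a x] f] t [[b y] g] [[b' y'] g']];
  apply: dext_eq.
- by rewrite /dext_2 /= linearPl.
- rewrite /dext_1 /dext_2 /= linearPl !linearP /= add_lfunE scale_lfunE scalerDr.
  by rewrite !scalerDr addr3 !scalerA [t * _]mulrC.
- apply: dual_eq => k c cG; rewrite /dext_mul_hom /dext_dual /dext_1 /dext_2 /=.
  rewrite !(add_lfunE, scale_lfunE, comp_lfunE, left_mulE, dext_varphiE _ _ _ _ cG).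
  rewrite !(linearPl, linearPr, linearP) /=.
  rewrite !scaleE; ring.
- by rewrite /dext_2 /= linearPr.
- rewrite /dext_1 /dext_2 /= linearPr !linearP /= add_lfunE scale_lfunE scalerDr.
  by rewrite !scalerDr addr3 !scalerA [t * _]mulrC.
- apply: dual_eq => k c cG; rewrite /dext_mul_hom /dext_dual /dext_1 /dext_2 /=.
  rewrite !(add_lfunE, scale_lfunE, comp_lfunE, left_mulE, dext_varphiE _ _ _ _ cG).
  rewrite !(linearPl, linearPr, linearP) /=.
  rewrite !scaleE; ring.
Qed.

Lemma dext_mul_bilinear : bilinear_for *:%R *:%R dext_mul.
Proof. exact: hext2_bilinear dext_mul_hom_bilinear. Qed.

HB.instance Definition _ :=
  bilinear_isBilinear.Build K (dext_space V1 V2) (dext_space V1 V2)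
    (dext_space V1 V2) *:%R *:%R dext_mul dext_mul_bilinear.

Lemma dext_mulE i j u v : u \in dext_grading G1 G2 i ->
  v \in dext_grading G1 G2 j -> dext_mul u v = dext_mul_hom i j u v.
Proof. exact: hext2E dext_mul_hom_bilinear _ _ _ _. Qed.

Hypothesis phiP : representation J2 G1 phi.
Hypothesis phi_AnDer : forall a, AnDer_s J1 B (phi a).
Hypothesis BP : pseudo_euclidean J1 B.

Lemma phi_homogeneous i a : a \in G2 i ->
  anti_superderivation J1 i (phi a) /\ supersymmetric_end G1 B i (phi a).
Proof.
move=> aG; have [D_ [phiE DP]] := phi_AnDer a.
suff -> : phi a = D_ i by exact: DP.
have phi_deg := phiP.1 _ _ aG.
apply/lfunP => x; rewrite -[x](hcomp_sum G1) !linear_sum; apply: eq_bigr => k _ /=.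
have xG := mem_hcomp G1 k x; move: (hcomp G1 k x) xG => {}x xG.
rewrite -(hcomp_id (phi_deg _ _ xG)) phiE sum_lfunE linear_sum big_bool /=.
have Dx d := hcompE (i (+) k) ((DP d).1.1 k x xG).
by case: i {aG phi_deg} Dx => Dx; rewrite !Dx; case: k {xG Dx};
   rewrite /= ?addr0 ?add0r.
Qed.

Lemma dext_mul_even i j u v : u \in dext_grading G1 G2 i ->
  v \in dext_grading G1 G2 j -> dext_mul u v \in dext_grading G1 G2 (i (+) j).
Proof.
move=> uG vG; rewrite (dext_mulE uG vG).
move: u v uG vG => [[a x] f] [[b y] g].
rewrite !mem_dext => /and3P[aG xG fG] /and3P[bG yG gG].
rewrite /dext_mul_hom /dext_1 /dext_2 /dext_dual /=.
apply/and3P; split.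
- exact: mlmul_even.
- have xa := phiP.1 _ _ aG _ _ yG; have yb := phiP.1 _ _ bG _ _ xG.
  by rewrite !memvD ?memvZ ?mlmul_even // addbC.
apply/dual_partP => c cG; rewrite !(add_lfunE, scale_lfunE, comp_lfunE, left_mulE).
rewrite (dext_varphiE _ _ _ _ cG).
have ac := mlmul_even J2 aG cG; have bc := mlmul_even J2 bG cG.
rewrite (elimT (dual_partP G2 j g) gG); last by case: (i) (j) ac => -[].
rewrite (elimT (dual_partP G2 i f) fG); last by case: (i) (j) bc => -[].
have [Bev _ _ _] := BP.
rewrite (Bev j) //; first by rewrite !(mulr0, scaler0, addr0).
have := phiP.1 _ _ cG _ _ xG; by case: (i) (j) => -[].
Qed.

Lemma dext_mulC i j u v : u \in dext_grading G1 G2 i ->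
  v \in dext_grading G1 G2 j -> dext_mul u v = (-1) ^+ (i && j) *: dext_mul v u.
Proof.
move=> uG vG; rewrite (dext_mulE uG vG) (dext_mulE vG uG).
move: u v uG vG => [[a x] f] [[b y] g].
rewrite !mem_dext => /and3P[aG xG fG] /and3P[bG yG gG].
have sgK (W : lmodType K) (w : W) : (-1) ^+ (i && j) *: ((-1) ^+ (j && i) *: w) = w.
  by rewrite andbC scalerA -expr2 sqrr_sign scale1r.
apply: dext_eq.
- exact: (mlmulC J2 aG bG).
- rewrite /dext_mul_hom /dext_1 /dext_2 /= !scalerDr sgK -(mlmulC J1 xG yG).
  by rewrite addrAC.
have [_ Bsym _ _] := BP.
apply: dual_eq => k c cG; rewrite /dext_mul_hom /dext_dual /dext_1 /dext_2 /=.
rewrite !(add_lfunE, scale_lfunE, comp_lfunE, left_mulE, dext_varphiE _ _ _ _ cG).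
have Ryx := Bsym _ _ _ _ yG (phiP.1 _ _ cG _ _ xG).
have [_ /(_ _ x y xG) Rc] := phi_homogeneous cG.
rewrite Ryx Rc.
have scaleE (t w : K) : t *: (w : K^o) = t * w by [].
rewrite !scaleE.
by case: (i) (j) (k) => -[] [] /=; ring.
Qed.

Lemma left_mul_jacobi i j k a b c : a \in G2 i -> b \in G2 j -> c \in G2 k ->
  mlmul J2 (mlmul J2 a b) c
  = - mlmul J2 a (mlmul J2 b c) - (-1) ^+ (i && j) *: mlmul J2 b (mlmul J2 a c).
Proof.
move=> aG bG cG; have := mlmul_jacobi J2 aG bG cG.
rewrite (mlmulC J2 (mlmul_even J2 aG bG) cG) (mlmulC J2 aG cG) linearZr_LR.
set p := mlmul J2 a _; set q := mlmul J2 b _; set r := mlmul J2 c _.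
move: p q r => p q r pqr0.
have := congr1 ( *:%R ((-1) ^+ (i && k))) pqr0.
rewrite scaler0 !scalerDr => pqr0'.
rewrite -opprD -[RHS]addr0 -[in RHS]pqr0'; apply/eqP.
have e1 : (-1) ^+ (i && k) *: ((-1) ^+ (i && k) *: p) = p.
  by rewrite scalerA -expr2 sqrr_sign scale1r.
have e2 : (-1) ^+ (i && k) *: ((-1) ^+ (i && j) *: q)
          = (-1) ^+ (i && j) *: ((-1) ^+ (i && k) *: q).
  by rewrite !scalerA mulrC.
have e3 : (-1) ^+ (i && k) *: ((-1) ^+ (j && k) *: r) = (-1) ^+ ((i (+) j) && k) *: r.
  by rewrite scalerA andb_addl signr_addb.
by rewrite e1 e2 e3 addKr eqxx.
Qed.

Lemma dext_mul_jacobi i j k u v w : u \in dext_grading G1 G2 i ->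
  v \in dext_grading G1 G2 j -> w \in dext_grading G1 G2 k ->
  (-1) ^+ (i && k) *: dext_mul u (dext_mul v w)
  + (-1) ^+ (i && j) *: dext_mul v (dext_mul w u)
  + (-1) ^+ (j && k) *: dext_mul w (dext_mul u v) = 0.
Proof.
move=> uG vG wG.
rewrite (dext_mulE uG (dext_mul_even vG wG)) (dext_mulE vG (dext_mul_even wG uG)).
rewrite (dext_mulE wG (dext_mul_even uG vG)).
rewrite (dext_mulE uG vG) (dext_mulE vG wG) (dext_mulE wG uG).
move: u v w uG vG wG => [[a x] f] [[b y] g] [[c z] h]; rewrite !mem_dext.
move=> /and3P[aG xG fG] /and3P[bG yG gG] /and3P[cG zG hG].
apply: dext_eq.
- exact: (mlmul_jacobi J2 aG bG cG).
- rewrite /dext_mul_hom /dext_1 /dext_2 /=.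
  have [_ _ Bnd _] := BP; apply: Bnd => t.
  have := congr1 (B^~ t) (mlmul_jacobi J1 xG yG zG); rewrite /= linear0l.
  rewrite !linearDl !linearZl_LR /= => Jxyz.
  have repE i' j' a' b' x' : a' \in G2 i' -> b' \in G2 j' ->
    phi (mlmul J2 a' b') x'
    = - phi a' (phi b' x') - (-1) ^+ (i' && j') *: phi b' (phi a' x').
    move=> a'G b'G; rewrite (phiP.2 _ _ _ _ a'G b'G).
    by rewrite !(add_lfunE, opp_lfunE, scale_lfunE, comp_lfunE).
  have derE i' j' k' a' y' z' : a' \in G2 i' -> y' \in G1 j' -> z' \in G1 k' ->
    phi a' (mlmul J1 y' z')
    = - ((-1) ^+ ((i' (+) j') && k') *: mlmul J1 z' (phi a' y'))
      - (-1) ^+ (i' && j') *: mlmul J1 y' (phi a' z').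
    move=> a'G y'G z'G; have [[phi_deg phiD] _] := phi_homogeneous a'G; rewrite (phiD j') //.
    by rewrite (mlmulC J1 (phi_deg _ _ y'G) z'G).
  rewrite (repE _ _ _ _ _ aG bG) (repE _ _ _ _ _ bG cG) (repE _ _ _ _ _ cG aG).
  rewrite !(linearDr, linearZr_LR) /= !(linearD, linearZ) /=.
  rewrite (derE _ _ _ _ _ _ aG yG zG) (derE _ _ _ _ _ _ bG zG xG).
  rewrite (derE _ _ _ _ _ _ cG xG yG).
  rewrite !(linearDl, linearZl_LR, linearNl) /=.
  move: (B (mlmul J1 x _) t) (B (mlmul J1 y _) t) (B (mlmul J1 z _) t) Jxyz.
  move=> p q r Jxyz.
  have -> : p = - ((-1) ^+ (i && k) * ((-1) ^+ (i && j) * q + (-1) ^+ (j && k) * r)).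
    have -> : p = (-1) ^+ (i && k) * ((-1) ^+ (i && k) * p).
      by rewrite mulrA -expr2 sqrr_sign mul1r.
    rewrite -mulrN; congr (_ * _); apply/eqP.
    by rewrite -addr_eq0 addrA Jxyz.
  by case: (i) (j) (k) => -[] [] /=; ring.
apply: dual_eq => l d dG.
rewrite /dext_mul_hom /dext_dual /dext_1 /dext_2 /=.
have [adG bdG cdG] := And3 (mlmul_even J2 aG dG) (mlmul_even J2 bG dG)
  (mlmul_even J2 cG dG).
rewrite !(add_lfunE, scale_lfunE, comp_lfunE, left_mulE, dext_varphiE _ _ _ _ dG,
  dext_varphiE _ _ _ _ adG, dext_varphiE _ _ _ _ bdG, dext_varphiE _ _ _ _ cdG).
have [_ Bsym _ Binv] := BP.
have scaleE (t e : K) : t *: (e : K^o) = t * e by [].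
have R0 m k' e x' y' : e \in G2 m -> x' \in G1 k' ->
  B (phi e x') y' = (-1) ^+ (m && k') * B x' (phi e y').
  by move=> eG x'G; have [_ phiS] := phi_homogeneous eG; apply: phiS.
have [[phid_deg phid_der] _] := phi_homogeneous dG.
(* For d of degree l and p, q, r of degrees m, n, o. *)
have R1 m n o p q r : p \in G1 m -> q \in G1 n -> r \in G1 o ->
  B (mlmul J1 q r) (phi d p)
  = - ((-1) ^+ (l && (n (+) o)) * (-1) ^+ ((l (+) n) && (o (+) m))
       * B (mlmul J1 r p) (phi d q))
    - (-1) ^+ (l && (n (+) o)) * (-1) ^+ (l && n) * (-1) ^+ (n && (l (+) o))
      * (-1) ^+ (m && n) * (-1) ^+ ((l (+) o) && (m (+) n))
      * B (mlmul J1 p q) (phi d r).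
  move=> pG qG rG; have qrG := mlmul_even J1 qG rG.
  have dqG := phid_deg _ _ qG; have drG := phid_deg _ _ rG.
  have -> : B (mlmul J1 q r) (phi d p)
    = (-1) ^+ (l && (n (+) o)) * B (phi d (mlmul J1 q r)) p.
    by rewrite (R0 _ _ _ _ _ dG qrG) mulrA -expr2 sqrr_sign mul1r.
  rewrite (phid_der _ _ _ qG) linearBl linearNl linearZl_LR /=.
  rewrite (Binv (phi d q)) (Bsym _ _ _ _ dqG (mlmul_even J1 rG pG)).
  rewrite (mlmulC J1 qG drG) linearZl_LR /= (Binv (phi d r)) (mlmulC J1 qG pG) linearZr_LR /=.
  rewrite (Bsym _ _ _ _ drG (mlmul_even J1 pG qG)).
  by case: (l) (m) (n) (o) => -[] [] [] /=; ring.
have R2 m n o e y' z' : e \in G2 m -> y' \in G1 n -> z' \in G1 o ->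
  B z' (phi (mlmul J2 e d) y')
  = - ((-1) ^+ (m && o) * B (phi e z') (phi d y'))
    - (-1) ^+ (m && l) * (-1) ^+ (l && o)
      * (-1) ^+ ((l (+) o) && (m (+) n)) * B (phi e y') (phi d z').
  move=> eG y'G z'G; rewrite (phiP.2 _ _ _ _ eG dG).
  rewrite !(add_lfunE, opp_lfunE, scale_lfunE, comp_lfunE) linearBr linearNr.
  rewrite linearZr_LR /= (R0 _ _ _ _ _ eG z'G).
  have [degE _] := phi_homogeneous eG.
  rewrite (Bsym _ _ _ _ (degE.1 _ _ y'G) (phid_deg _ _ z'G)).
  rewrite (R0 _ _ _ _ _ dG z'G).
  by case: (l) (m) (n) (o) => -[] [] [] /=; ring.
have fE m n (e : dual_space V2) p q : p \in G2 m -> q \in G2 n ->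
  e (mlmul J2 (mlmul J2 p q) d) = - (e (mlmul J2 p (mlmul J2 q d)) : K)
    - (-1) ^+ (m && n) * (e (mlmul J2 q (mlmul J2 p d)) : K).
  by move=> pG qG; rewrite (left_mul_jacobi pG qG dG) linearB linearN linearZ.
rewrite (fE _ _ _ _ _ aG bG) (fE _ _ _ _ _ bG cG) (fE _ _ _ _ _ cG aG).
rewrite (R2 _ _ _ _ _ _ aG yG zG) (R2 _ _ _ _ _ _ bG zG xG).
rewrite (R2 _ _ _ _ _ _ cG xG yG).
rewrite !(linearDl B) !(linearZl_LR B) (R1 _ _ _ _ _ _ xG yG zG).
rewrite !scaleE [RHS]lfunE /=.
by case: (i) (j) (k) (l) => -[] [] [] /=; ring.
Qed.

Definition double_extension : mockLie (dext_grading G1 G2) :=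
  @MockLie K (dext_space V1 V2) (dext_grading G1 G2) dext_mul
    dext_mul_even dext_mulC dext_mul_jacobi.

End DoubleExtension.

(* Main.v *)
(* On homogeneous elements, writing out both sides of the invariance identity,
   the terms pair off: B(phi(b)x, z) with B(x, phi(b)z) by supersymmetry of
   phi(b); varphi(x, y)(c) with B(x, phi(c)y), and B(phi(a)y, z) with
   varphi(y, z)(a), by the definition of varphi and the symmetries of B and
   phi; the coadjoint terms by supercommutativity of the product of J2.       *)

Require Import Defs.
From HB Require Import structures.
From mathcomp Require Import all_boot all_order all_algebra.
From mathcomp Require Import ring.

Import GRing.Theory.
Local Open Scope ring_scope.

Set Implicit Arguments.
Unset Strict Implicit.

(** With the sign replaced by an arbitrary scalar [s], one computation serves every pair of degrees
    in [hext2]. *)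
Lemma dext_form_hom_bilinear (K : fieldType) (V1 V2 : vectType K)
    (B : {biscalar V1}) (sigma : {biscalar V2}) (s : K) :
  bilinear_for *%R *%R (fun u v : dext_space V1 V2 =>
    B (dext_1 u) (dext_1 v) + sigma (dext_2 u) (dext_2 v)
    + (dext_dual u (dext_2 v) : K) + s * (dext_dual v (dext_2 u) : K)).
Proof.
have scaleE (t e : K) : t *: (e : K^o) = t * e by [].
split=> [[[b y] g] t [[a x] f] [[a' x'] f'] | [[a x] f] t [[b y] g] [[b' y'] g']];
  rewrite /dext_1 /dext_2 /dext_dual /=
    !(linearPl, linearPr, linearP, add_lfunE, scale_lfunE) /= !scaleE; ring.
Qed.

Section DextForm.
Variables (K : fieldType) (V1 V2 : vectType K).
Variables (G1 : grading V1) (G2 : grading V2).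
Variables (B : {biscalar V1}) (sigma : {biscalar V2}).
Local Notation Bt := (dext_form G1 G2 B sigma).

Lemma dext_form_bilinear : bilinear_for *%R *%R Bt.
Proof.
have F_bilin i j := dext_form_hom_bilinear B sigma ((-1) ^+ (i && j)).
(* The general lemma is about module-valued maps; over [K^o] scaling is multiplication in K. *)
exact (@hext2_bilinear K _ _ K^o _ _ _ F_bilin).
Qed.

HB.instance Definition _ :=
  bilinear_isBilinear.Build K (dext_space V1 V2) (dext_space V1 V2) K
    *%R *%R Bt dext_form_bilinear.

Lemma dext_formE i j a x f b y g :
  (a, x, f) \in dext_grading G1 G2 i -> (b, y, g) \in dext_grading G1 G2 j ->
  Bt (a, x, f) (b, y, g)
  = B x y + sigma a b + (f b : K) + (-1) ^+ (i && j) * (g a : K).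
Proof.
have F_bilin i' j' := dext_form_hom_bilinear B sigma ((-1) ^+ (i' && j')).
exact (@hext2E K _ _ K^o _ _ _ F_bilin i j (a, x, f) (b, y, g)).
Qed.

(** Exchanging the arguments swaps the two evaluation terms up to the sign, which squares to 1. *)
Lemma dext_form_supersymmetric :
  supersymmetric_form G1 B -> supersymmetric_form G2 sigma ->
  supersymmetric_form (dext_grading G1 G2) Bt.
Proof.
move=> Bsym sigma_sym i j [[a x] f] [[b y] g] uG vG.
rewrite (dext_formE uG vG) (dext_formE vG uG).
move: uG vG; rewrite !mem_dext => /and3P[aG xG _] /and3P[bG yG _].
rewrite (Bsym _ _ _ _ xG yG) (sigma_sym _ _ _ _ aG bG).
by case: (i) (j) => -[] /=; ring.
Qed.

End DextForm.

(** Both sides are trilinear and every vector is the sum of its homogeneous components. This gives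
    access to the explicit formulas for [dext_mul] and [dext_form]. *)
Lemma invariant_form_hom (K : fieldType) (V : vectType K) (G : grading V)
    (J : mockLie G) (B : {biscalar V}) :
  (forall i j k x y z, x \in G i -> y \in G j -> z \in G k ->
     B (mlmul J x y) z = B x (mlmul J y z)) ->
  invariant_form J B.
Proof.
move=> Binv x y z.
rewrite -[x](hcomp_sum G) -[y](hcomp_sum G) -[z](hcomp_sum G) !big_bool /=.
rewrite !(linearDl, linearDr) /=.
rewrite !(Binv _ _ _ _ _ _ (mem_hcomp _ _ _) (mem_hcomp _ _ _)
  (mem_hcomp _ _ _)).
ring.
Qed.

Theorem proposition4p4 (K : fieldType) (charK0 : [pchar K] =i pred0)
    (V1 V2 : vectType K) (G1 : grading V1) (G2 : grading V2)
    (J1 : mockLie G1) (B : {biscalar V1}) (BP : pseudo_euclidean J1 B)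
    (J2 : mockLie G2)
    (phi : {linear V2 -> 'End(V1)}) (phiP : representation J2 G1 phi)
    (phi_AnDer : forall a : V2, AnDer_s J1 B (phi a))
    (sigma : {biscalar V2})
    (sigma_sym : supersymmetric_form G2 sigma)
    (sigma_inv : invariant_form J2 sigma) :
  let J := double_extension phiP phi_AnDer BP in
  let Bt := dext_form G1 G2 B sigma in
  [/\ bilinear_for *%R *%R Bt,
      supersymmetric_form (dext_grading G1 G2) Bt
    & invariant_form J Bt].
Proof.
have [_ Bsym _ Binv] := BP.
move=> J Bt; split; first exact: dext_form_bilinear.
  exact: dext_form_supersymmetric.
apply: invariant_form_hom.
move=> i j k [[a x] f] [[b y] g] [[c z] h] uG vG wG.
(* The products are homogeneous, so [dext_formE] applies to them with degrees i + j and j + k. *)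
have uvG := mlmul_even J uG vG; have vwG := mlmul_even J vG wG.
move: uvG vwG; rewrite /= (dext_mulE J1 J2 B phi uG vG) (dext_mulE J1 J2 B phi vG wG).
rewrite /dext_mul_hom => uvG vwG; rewrite /Bt (dext_formE _ _ uvG wG)
  (dext_formE _ _ uG vwG).
rewrite /dext_1 /dext_2 /dext_dual /=.
move: uG vG wG {uvG vwG}; rewrite !mem_dext.
move=> /and3P[aG xG _] /and3P[bG yG _] /and3P[cG zG _].
have scaleE (t e : K) : t *: (e : K^o) = t * e by [].
rewrite !(add_lfunE, scale_lfunE, comp_lfunE, left_mulE,
  dext_varphiE _ _ _ _ _ _ cG, dext_varphiE _ _ _ _ _ _ aG).
rewrite !(linearDl, linearDr, linearZl_LR, linearZr_LR) /=.
have phi_deg e l m w : e \in G2 l -> w \in G1 m -> phi e w \in G1 (l (+) m).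
  by move=> eG; apply: phiP.1.
(* [AnDer_s] only decomposes [phi e]; as [phi] is even, [phi e] is its own component of degree l. *)
have phi_sym e l m w t : e \in G2 l -> w \in G1 m ->
    B (phi e w) t = (-1) ^+ (l && m) * B w (phi e t).
  by move=> eG wG; have [_] := phi_homogeneous phiP phi_AnDer eG; apply.
(* Only the g and h terms need commuting: f is evaluated at the product of b and c on both sides. *)
rewrite Binv sigma_inv (mlmulC J2 bG aG) (mlmulC J2 cG aG) !linearZ /=.
rewrite (Bsym _ _ _ _ zG (phi_deg _ _ _ _ aG yG)).
rewrite (Bsym _ _ _ _ yG (phi_deg _ _ _ _ cG xG)).
rewrite (phi_sym _ _ _ _ _ bG xG) (phi_sym _ _ _ _ _ cG xG) !scaleE.
(* Both sides now involve the same scalars; only the signs remain, in eight parity cases. *)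
by case: (i) (j) (k) => -[] [] /=; ring.
Qed.
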